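(* Let $X_K=\{x_1,\dots,x_K\}\subset\mathbf{S}^n$ be a set of points not contained in any closed hemisphere, and let $\mu_1,\dots,\mu_K>0$ satisfy $\sum_{i=1}^K\mu_i=\sigma(\mathbf{S}^n)$ and, for any (solid) polyhedral convex cone $V\neq\mathbb{R}^{n+1}$ with vertex at $\mathcal{O}$, possibly degenerate, $\sum_{i:\,x_i\notin\mathbf{S}^n\cap V}\mu_i>\sigma((\mathbf{S}^n\cap V)^* )$. Let $\tilde P\in\mathcal{F}_K^n$, with support function $\tilde h$ and radial function $\tilde\rho$, be a minimizer of $\mathcal{Q}_K$, i.e. $\mathcal{Q}_K[\tilde h,\tilde\rho]=\inf_{\mathcal{A}_K}\mathcal{Q}_K[h,p]=\inf_{\mathcal{F}_K^n}\mathcal{Q}_K[h,\rho]$. Then $$\sigma(\alpha_{\tilde P}(x_i))=\mu_i\quad\text{for all } i=1,\dots,K.$$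
   Context: $\mathbf{S}^n$ is the unit sphere in $\mathbb{R}^{n+1}$, $n\ge1$, centered at the origin $\mathcal{O}$, and $\sigma$ is the standard Lebesgue measure on $\mathbf{S}^n$. For $\omega\subset\mathbf{S}^n$, $\omega^*=\{y\in\mathbf{S}^n:\langle x,y\rangle\le0\ \forall x\in\omega\}$. $\mathcal{F}^n$ is the set of boundaries of compact convex sets in $\mathbb{R}^{n+1}$ containing $\mathcal{O}$ in their interior; for $F\in\mathcal{F}^n$, its radial function $\rho(x)$ is the distance from $\mathcal{O}$ to the point where the ray in direction $x\in\mathbf{S}^n$ meets $F$, and its support function is $h(N)=\sup_{x}\rho(x)\langle x,N\rangle$. The generalized Gauss map $\alpha_F(x)$, $x\in\mathbf{S}^n$, is the set of outward unit normals of all supporting hyperplanes to $F$ at $\rho(x)x$. $\mathcal{F}_K^n$ is the set of convex polytopes in $\mathcal{F}^n$ all of whose vertices lie on the rays from $\mathcal{O}$ through $x_1,\dots,x_K$. $\mathcal{A}_K=\{(h,p)\in C(\mathbf{S}^n)\times\mathbb{R}^K: h>0,\ p_i>0,\ \log h(N)-\log p_i\ge\log\langle x_i,N\rangle$ whenever $\langle x_i,N\rangle>0\}$, and $\mathcal{Q}_K[h,p]=\int_{\mathbf{S}^n}\log h\,d\sigma-\sum_{i}\mu_i\log p_i$; for a polytope with support function $h$ and radial function $\rho$, $\mathcal{Q}_K[h,\rho]$ means $\mathcal{Q}_K[h,(\rho(x_1),\dots,\rho(x_K))]$. *)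

(* Defs.v *)
From HB Require Import structures.
From mathcomp Require Import all_boot all_order all_algebra.
From mathcomp Require Import all_classical all_reals all_analysis.
Set Implicit Arguments.
Unset Strict Implicit.
Unset Printing Implicit Defensive.
Import Order.TTheory GRing.Theory Num.Theory.
Import numFieldNormedType.Exports.
Local Open Scope classical_set_scope.
Local Open Scope ring_scope.

Section Defs.
Variable R : realType.
Variable n : nat.
Notation V := 'rV[R]_(n.+1).

Definition dotp (x y : V) : R := \sum_(i < n.+1) x 0 i * y 0 i.

Definition sphere : set V := [set x | dotp x x = 1].

Definition box (a b : V) : set V :=
  [set x | forall i : 'I_n.+1, a 0 i <= x 0 i <= b 0 i].
Definition box_vol (a b : V) : R :=
  \prod_(i < n.+1) Num.max (b 0 i - a 0 i) 0.
Definition leb_outer (E : set V) : \bar R :=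
  ereal_inf [set s | exists a b : nat -> V,
     E `<=` \bigcup_k box (a k) (b k) /\
     s = (\sum_(0 <= k <oo) (box_vol (a k) (b k))%:E)%E].

(* Standard (surface) measure of a subset of S^n, via the cone construction:
   sigma(w) = (n+1) * vol{ t x : x in w, 0 < t <= 1 }. *)
Definition sigma (w : set V) : \bar R :=
  (n.+1)%:R%:E * leb_outer [set y | exists (t : R) x, (0 < t <= 1)%R /\ w x /\ sphere x /\ y = t *: x].

(* Integral over S^n (w.r.t. sigma) of a real function f, by the layer-cake
   formula int f = int_0^oo sigma(f > t) dt - int_0^oo sigma(f < -t) dt
   (used only for continuous f on S^n, for which it is the Lebesgue integral). *)
Definition sphere_integral (f : V -> R) : \bar R :=
  (\int[@lebesgue_measure R]_(t in `[0%R, +oo[)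
      sigma [set x | sphere x /\ (t < f x)%R]) -
  (\int[@lebesgue_measure R]_(t in `[0%R, +oo[)
      sigma [set x | sphere x /\ (f x < - t)%R]).

Definition dual_set (w : set V) : set V :=
  [set y | sphere y /\ forall x, w x -> dotp x y <= 0].

Definition convex_set (C : set V) : Prop :=
  forall x y t, C x -> C y -> 0 <= t <= 1 -> C (t *: x + (1 - t) *: y).

Definition convex_body (C : set V) : Prop :=
  compact C /\ convex_set C /\ (C°) 0.

Definition boundary (C : set V) : set V := closure C `\` C°.

Definition in_Fn (F : set V) : Prop := exists C, convex_body C /\ F = boundary C.

Definition radial (F : set V) (x : V) : R :=
  sup [set t : R | 0 < t /\ F (t *: x)].

Definition supportf (F : set V) (N : V) : R :=
  sup [set radial F x * dotp x N | x in sphere].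

Definition gauss_map (F : set V) (x : V) : set V :=
  [set N | sphere N /\
    forall y, F y -> dotp y N <= dotp (radial F x *: x) N].

Definition conv_hull (m : nat) (v : 'I_m -> V) : set V :=
  [set y | exists l : 'I_m -> R, (forall j, 0 <= l j) /\
     \sum_(j < m) l j = 1 /\ y = \sum_(j < m) l j *: v j].

Definition vertex (C : set V) (v : V) : Prop :=
  C v /\ forall y z t, C y -> C z -> 0 < t < 1 -> v = t *: y + (1 - t) *: z ->
    y = z.

Definition in_FKn (K : nat) (x : 'I_K -> V) (F : set V) : Prop :=
  exists (m : nat) (v : 'I_m -> V),
    convex_body (conv_hull v) /\ F = boundary (conv_hull v) /\
    forall w, vertex (conv_hull v) w -> exists i t, 0 < t /\ w = t *: x i.

Definition QK (K : nat) (mu : 'I_K -> R) (h : V -> R) (p : 'I_K -> R) : \bar R :=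
  sphere_integral (fun N => ln (h N)) - (\sum_(i < K) mu i * ln (p i))%:E.

Definition in_AK (K : nat) (x : 'I_K -> V) (h : V -> R) (p : 'I_K -> R) : Prop :=
  {within sphere, continuous h} /\
  (forall N, sphere N -> 0 < h N) /\
  (forall i, 0 < p i) /\
  (forall i N, sphere N -> 0 < dotp (x i) N ->
     ln (h N) - ln (p i) >= ln (dotp (x i) N)).

Definition poly_cone (m : nat) (u : 'I_m.+1 -> V) : set V :=
  [set y | exists c : 'I_m.+1 -> R, (forall j, 0 <= c j) /\
     y = \sum_(j < m.+1) c j *: u j].

End Defs.
Arguments sphere {R n}.

(* Main.v *)
(** Put p j = rho(x j), h_q(N) = max_j q_j <x j, N>, so that the support function of the polytope is h_p.
    Multiplying p i by e^s produces q with (h_q, q) admissible, hence Q[h_p, p] <= Q[h_q, q] for every real s.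
    Let B(c) be the set of N with p_j <x j, N> <= c p_i <x i, N> for all j <> i.  Pointwise
    ln h_q - ln h_p <= s on B(e^s) and <= 0 elsewhere, so that mu_i s <= s sigma(B(e^s)).
    Letting s tend to 0 from both sides gives sigma(B(1)) >= mu_i and sigma(U) <= mu_i, where U is the union of
    the B(c), c < 1.  Now B(1) is the generalized Gauss image of x i, and B(1) \ U lies in finitely many
    hyperplanes <p_j x_j - p_i x_i, N> = 0, which are null because the points x_j are distinct. *)
Require Import Defs.
From HB Require Import structures.
From mathcomp Require Import all_boot all_order all_algebra.
From mathcomp Require Import all_classical all_reals all_analysis.
From mathcomp Require Import measurable_realfun.
From mathcomp Require Import ring lra.
Set Implicit Arguments.
Unset Strict Implicit.
Unset Printing Implicit Defensive.
Import Order.TTheory GRing.Theory Num.Theory.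
Import numFieldNormedType.Exports.
Local Open Scope classical_set_scope.
Local Open Scope ring_scope.

(** * Lebesgue outer measure by boxes *)

Section OuterMeasure.
Context (R : realType) (n : nat).
Notation V := 'rV[R]_(n.+1).
Implicit Types (a b v y : V) (E : set V).

Lemma box_vol_ge0 a b : 0 <= box_vol a b.
Proof. by apply: prodr_ge0 => i _; rewrite le_max lexx orbT. Qed.

Lemma box_vol_eq0 a b : (exists i, b 0 i <= a 0 i) -> box_vol a b = 0.
Proof.
move=> [i bai]; rewrite /box_vol (bigD1 i)//= (max_idPr _) ?mul0r//.
by rewrite subr_le0.
Qed.

Lemma leb_outer_ge0 E : (0 <= leb_outer E)%E.
Proof.
apply: le_ereal_inf_tmp => _ [a [b [_ ->]]].
by apply: nneseries_ge0 => k _ _; rewrite lee_fin box_vol_ge0.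
Qed.

Lemma leb_outer_le (a b : nat -> V) E : E `<=` \bigcup_k box (a k) (b k) ->
  (leb_outer E <= \sum_(0 <= k <oo) (box_vol (a k) (b k))%:E)%E.
Proof. by move=> Eab; apply: ereal_inf_lbound; exists a, b. Qed.

(** The two corner sequences are packed into one pair so that [choice] can later select a whole
    cover for each set of a countable family. *)
Lemma leb_outer_adherent E (e : R) : 0 < e -> (leb_outer E < +oo)%E ->
  exists ab : (nat -> V) * (nat -> V),
    E `<=` \bigcup_k box (ab.1 k) (ab.2 k) /\
    (\sum_(0 <= k <oo) (box_vol (ab.1 k) (ab.2 k))%:E <= leb_outer E + e%:E)%E.
Proof.
move=> e0 Eoo.
have Efin : leb_outer E \is a fin_num by rewrite ge0_fin_numE// leb_outer_ge0.
have [_ [a [b [Eab ->]]] /ltW ?] := lb_ereal_inf_adherent e0 Efin.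
by exists (a, b).
Qed.

Lemma leb_outer_box a b : (leb_outer (box a b) <= (box_vol a b)%:E)%E.
Proof.
(* The cover is the box itself followed by degenerate boxes [box a a], of volume 0 because there is
   at least one coordinate. *)
pose B k := if k is 0%N then b else a.
apply: (le_trans (@leb_outer_le (fun=> a) B _ _)).
  by move=> y aby; exists 0%N.
rewrite nneseries_recl//=; last by move=> k _; rewrite lee_fin box_vol_ge0.
rewrite eseries0 ?adde0// => -[|k]//= _ _.
by rewrite box_vol_eq0//; exists ord0.
Qed.

Lemma leb_outer_set0 : leb_outer (@set0 V) = 0%E.
Proof.
apply/eqP; rewrite eq_le leb_outer_ge0 andbT.
apply: (le_trans (@leb_outer_le (fun=> 0) (fun=> 0) _ _)) => //.
by rewrite eseries0// => k _ _; rewrite box_vol_eq0//; exists ord0.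
Qed.

Lemma leb_outer_subadditive E (F : (set V)^nat) :
  subset_sigma_subadditive (@leb_outer R n) E F.
Proof.
move=> EF; have [[i Fi]|noo] := pselect (exists i, leb_outer (F i) = +oo%E).
  rewrite (eseries_pinfty _ _ Fi) ?leey// => k _.
  by rewrite -ltNye (lt_le_trans _ (leb_outer_ge0 _)).
apply/lee_addgt0Pr => e e0.
apply: (le_trans _ (epsilon_trick _ _ (ltW e0))); last first.
  by move=> k; exact: leb_outer_ge0.
have ek k : 0 < e / (2 ^ k.+1)%:R by rewrite divr_gt0// ltr0n expn_gt0.
have Fk k : (leb_outer (F k) < +oo)%E.
  by rewrite ltey; apply/eqP => Fko; apply: noo; exists k.
have [G GP] := choice (fun k => @leb_outer_adherent _ _ (ek k) (Fk k)).
pose w (p : nat * nat) := ((G p.1).1 p.2, (G p.1).2 p.2).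
have w0 p : (0 <= (box_vol (w p).1 (w p).2)%:E)%E by rewrite lee_fin box_vol_ge0.
(* A bijection from the naturals onto pairs lists all boxes of all the covers in a single sequence;
   the cover of [F k] may exceed its outer measure by e / 2^(k+1). *)
have /card_esym/ppcard_eqP[f] := card_nat2.
have Ef : E `<=` \bigcup_k box (w (f k)).1 (w (f k)).2.
  move=> y /EF[i _ /((GP i).1)[j _ yij]]; exists (f^-1%FUN (i, j)) => //.
  by rewrite invK ?inE.
apply: (le_trans (leb_outer_le Ef)).
rewrite nneseries_esumT//.
rewrite -(reindex_esum setT setT f (fun p => (box_vol (w p).1 (w p).2)%:E));
  last exact: 'bij_f.
have -> : [set: nat * nat] = [set: nat] `*`` (fun=> [set: nat]).
  by apply/seteqP; split.
rewrite -(esum_esum (a := fun i j => (box_vol (w (i, j)).1 (w (i, j)).2)%:E)); last first.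
  by move=> i j _ _; exact: (w0 (i, j)).
rewrite -nneseries_esumT; last by move=> i; apply: esum_ge0 => j _; exact: (w0 (i, j)).
apply: lee_nneseries => [i _ _|i _]; first by apply: esum_ge0 => j _; exact: (w0 (i, j)).
rewrite -nneseries_esumT; last by move=> j; exact: (w0 (i, j)).
exact: (GP i).2.
Qed.

HB.instance Definition _ := isSubsetOuterMeasure.Build R V (@leb_outer R n)
  leb_outer_set0 leb_outer_ge0 leb_outer_subadditive.

Definition set_coord (i : 'I_n.+1) (c : R) v : V :=
  \row_j (if j == i then c else v 0 j).

(** The hyperplane y_i = c cuts the box in two. When it misses the box, one piece is degenerate or
    has reversed corners, and the truncation at 0 in [box_vol] gives it volume 0. *)
Lemma box_vol_split i c a b :
  box_vol a (set_coord i (Num.min (b 0 i) c) b) +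
  box_vol (set_coord i (Num.max (a 0 i) c) a) b = box_vol a b.
Proof.
rewrite /box_vol [X in X + _](bigD1 i)//= [X in _ + X](bigD1 i)//= [RHS](bigD1 i)//=.
rewrite !mxE eqxx.
under eq_bigr => j ji do rewrite mxE (negbTE ji).
under [X in _ + _ * X]eq_bigr => j ji do rewrite mxE (negbTE ji).
rewrite -mulrDl; congr (_ * _).
rewrite /Num.max /Num.min.
by repeat case: ifPn => /=; lra.
Qed.

(** Cutting each box of a nearly optimal cover of X along the hyperplane yields covers of both parts
    of X whose volumes add up to that of the original cover. *)
Lemma halfspace_caratheodory i c :
  (@leb_outer R n).-caratheodory [set y | y 0 i <= c].
Proof.
apply: le_caratheodory_measurable => X.
have [Xoo|Xoo] := eqVneq (leb_outer X) +oo%E.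
  by apply: (le_trans (leey _)); rewrite -Xoo.
apply/lee_addgt0Pr => e e0.
have [|[a b] /= [Xab abe]] := @leb_outer_adherent X _ e0; first by rewrite ltey.
apply: le_trans abe.
have E : (\sum_(0 <= k <oo) (box_vol (a k) (b k))%:E =
   \sum_(0 <= k <oo) (box_vol (a k) (set_coord i (Num.min (b k 0 i) c) (b k)))%:E
   + \sum_(0 <= k <oo) (box_vol (set_coord i (Num.max (a k 0 i) c) (a k)) (b k))%:E)%E.
  rewrite -nneseriesD => [|k _ _|k _ _]; rewrite ?lee_fin ?box_vol_ge0//.
  by apply: eq_eseriesr => k _; rewrite -EFinD box_vol_split.
rewrite E; apply: leeD; apply: leb_outer_le.
  move=> y [/Xab[k _ yk] /= yc]; exists k => // j; rewrite !mxE.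
  by have := yk j; case: eqP => [->|//] /andP[-> ?] /=; rewrite le_min yc andbT.
move=> y [/Xab[k _ yk] /= /negP]; rewrite -ltNge => yc; exists k => // j; rewrite !mxE.
by have := yk j; case: eqP => [->|//] /andP[? ->] /=; rewrite ge_max (ltW yc) !andbT.
Qed.

Lemma leb_outer_shift v E : (leb_outer [set y : V | E (y + v)%R] <= leb_outer E)%E.
Proof.
apply: le_ereal_inf_tmp => _ [a [b [Eab ->]]].
apply: (le_trans (@leb_outer_le (fun k => a k - v) (fun k => b k - v) _ _)).
  move=> y /Eab[k _ yk]; exists k => // j.
  by have := yk j; rewrite !mxE lerBlDr lerBrDr.
apply: lee_nneseries => [k _ _|k _]; rewrite lee_fin ?box_vol_ge0//.
rewrite le_eqVlt; apply/orP; left; apply/eqP; apply: eq_bigr => j _.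
by rewrite !mxE; congr (Num.max _ _); ring.
Qed.

End OuterMeasure.

(** The type [lebT] carries the sigma-algebra of Carathéodory measurable sets, on which [lebM] is
    countably additive, while its value on any set is still [leb_outer]. *)
Definition lebO (R : realType) n : {outer_measure set 'rV[R]_(n.+1) -> \bar R} :=
  @leb_outer R n.
Notation lebT R n := (caratheodory_type (lebO R n)).
Definition lebM (R : realType) n : {measure set (lebT R n) -> \bar R} :=
  (lebO R n : set (lebT R n) -> \bar R).

Section Measurability.
Context (R : realType) (n : nat).
Notation T := (lebT R n).
Notation V := 'rV[R]_(n.+1).

Lemma measurable_coord (i : 'I_n.+1) :
  measurable_fun [set: T] (fun y : T => (y : V) 0 i).
Proof.
move=> _; apply: (measurability _ (RGenOInfty.measurableE R)) => //.
move=> _ [_ [c ->] <-]; rewrite setTI.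
rewrite (_ : _ @^-1` _ = ~` [set y : V | y 0 i <= c]).
  by apply: measurableC; exact: halfspace_caratheodory.
by apply/seteqP; split => y /=; rewrite in_itv/= andbT ltNge => /negP.
Qed.

Lemma measurable_dotp (b : V) : measurable_fun [set: T] (fun y : T => dotp b y).
Proof.
apply: measurable_sum => i; apply: measurable_funM => //.
exact: measurable_coord.
Qed.

Lemma measurable_sqnorm : measurable_fun [set: T] (fun y : T => dotp (y : V) y).
Proof.
by apply: measurable_sum => i; apply: measurable_funM; exact: measurable_coord.
Qed.

End Measurability.

(** * The spherical measure as a cone measure *)

Section ConeMeasure.
Context (R : realType) (n : nat).
Notation T := (lebT R n).
Notation V := 'rV[R]_(n.+1).
Implicit Types (b v y : V).

Lemma measurable_dotp_shift b v :
  measurable_fun [set: T] (fun y : T => dotp b (y + v : V)).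
Proof.
rewrite /dotp; under eq_fun do under eq_bigr do rewrite mxE.
apply: measurable_sum => i; apply: measurable_funM => //.
by apply: measurable_funD => //; exact: measurable_coord.
Qed.

Lemma measurable_sqnorm_shift v :
  measurable_fun [set: T] (fun y : T => dotp (y + v : V) (y + v : V)).
Proof.
rewrite /dotp; under eq_fun do under eq_bigr do rewrite mxE.
apply: measurable_sum => i.
by apply: measurable_funM; apply: measurable_funD => //; exact: measurable_coord.
Qed.

(** Without the origin, this is exactly the union of the segments t x, 0 < t <= 1, from which
    [sigma] is built. *)
Definition punctured_ball : set T := [set y : V | 0 < dotp y y <= 1].

Lemma measurable_punctured_ball_shift v :
  measurable ([set y | punctured_ball (y + v : V)] : set T).
Proof.
have mf := measurable_sqnorm_shift v.
rewrite (_ : [set _ | _] =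
   ([set: T] `&` [set y : T | dotp (y + v : V) (y + v : V) <= 1]) `&`
   ~` ([set: T] `&` [set y : T | dotp (y + v : V) (y + v : V) <= 0])).
  apply: measurableI; first exact: measurable_fun_le.
  by apply: measurableC; exact: measurable_fun_le.
apply/seteqP; split => y /=; rewrite /punctured_ball/= ltNge.
  by move=> /andP[/negP y0 y1]; split => // -[_].
by move=> [[_ ->]]; rewrite andbT => y0; apply/negP => ?; exact: y0.
Qed.

Lemma measurable_punctured_ball : measurable punctured_ball.
Proof.
have := measurable_punctured_ball_shift 0.
by under eq_set do rewrite addr0.
Qed.

Lemma sqr_coord_le_sqnorm y i : y 0 i ^+ 2 <= dotp y y.
Proof.
rewrite /dotp (bigD1 i)//= -expr2 lerDl sumr_ge0// => j _.
by rewrite -expr2 sqr_ge0.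
Qed.

Lemma punctured_ball_coord y i : punctured_ball y -> `|y 0 i| <= 1.
Proof.
move=> /andP[_ y1]; rewrite -(@expr_le1 _ 2)// real_normK ?num_real//.
exact: le_trans (sqr_coord_le_sqnorm _ _) y1.
Qed.

Lemma punctured_ball_lty : (lebM R n punctured_ball < +oo)%E.
Proof.
apply: (@le_lt_trans _ _ (box_vol (const_mx (-1) : V) (const_mx 1))%:E); last exact: ltry.
apply: le_trans (leb_outer_box _ _); apply: le_outer_measure => y yD i.
by rewrite !mxE -ler_norml punctured_ball_coord.
Qed.

(* Translates of the slice along a transversal direction are disjoint,
   have the same measure, and stay in a fixed box. *)
Lemma leb_outer_hyperplane b : b != 0 ->
  leb_outer ([set y : V | dotp b y = 0] `&` punctured_ball) = 0%E.
Proof.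
move=> b0; have [k bk] : exists k, b 0 k != 0.
  apply: contrapT => nk; move/eqP: b0; apply; apply/rowP => j; rewrite mxE.
  by apply: contrapT => /eqP bj; apply: nk; exists j.
set A := (_ `&` _).
pose v (i : nat) : V := \row_j (if j == k then i.+1%:R^-1 else 0).
have bv y i : dotp b (y + v i) = dotp b y + b 0 k / i.+1%:R.
  rewrite /dotp; under eq_bigr do rewrite mxE mulrDr.
  rewrite big_split/=; congr (_ + _); rewrite (bigD1 k)//= mxE eqxx big1 ?addr0//.
  by move=> j jk; rewrite mxE (negbTE jk) mulr0.
pose F i : set T := [set y | A (y + v i)%R].
have mF i : measurable (F i).
  rewrite (_ : F i = ([set: T] `&` (fun y : T => dotp b (y + v i : V)) @^-1` [set 0%R]) `&`
     [set y | punctured_ball (y + v i : V)]).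
    apply: measurableI; last exact: measurable_punctured_ball_shift.
    exact: (measurable_dotp_shift b (v i)).
  by apply/seteqP; split => y /=; [move=> [? ?]|move=> [[_ ?] ?]].
have tF : trivIset [set: nat] F.
  move=> i j _ _ [y [[/= yi _] [/= yj _]]].
  have /(mulfI bk)/invr_inj : b 0 k / i.+1%:R = b 0 k / j.+1%:R.
    by apply: (@addrI _ (dotp b y)); rewrite -!bv yi yj.
  by move=> /eqP; rewrite eqr_nat => /eqP [].
have FA i : (leb_outer A <= leb_outer (F i))%E.
  apply: le_trans (leb_outer_shift (- v i) _); apply: le_outer_measure => y Ay /=.
  by rewrite /F/= subrK.
pose a : V := const_mx (-2); pose c : V := const_mx 2.
(* Coordinates in [punctured_ball] lie in [-1, 1] and the shifts in [0, 1], so the bounds -2 and 2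
   suffice for every translate. *)
have FB i : F i `<=` box a c.
  move=> y [_ /punctured_ball_coord yi] j; have := yi j.
  rewrite !mxE ler_norml; case: eqP => _; last by rewrite addr0; lra.
  have : 0 <= i.+1%:R^-1 :> R by rewrite invr_ge0.
  have : i.+1%:R^-1 <= 1 :> R by rewrite invf_le1 ?ler1n ?ltr0n.
  by move: (i.+1%:R^-1) => s; lra.
have Afin : leb_outer A \is a fin_num.
  rewrite ge0_fin_numE ?leb_outer_ge0//; apply: le_lt_trans (ltry (box_vol a c)).
  apply: le_trans (FA 0%N) (le_trans _ (leb_outer_box _ _)).
  exact: le_outer_measure.
have NA N : (N%:R%:E * leb_outer A <= (box_vol a c)%:E)%E.
  apply: le_trans (leb_outer_box _ _).
  apply: (@le_trans _ _ (lebM R n (\big[setU/set0]_(i < N) F i))); last first.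
    apply: (le_outer_measure (lebO R n)); rewrite -bigcup_mkord; exact: bigcup_sub.
  rewrite measure_bigsetU//.
  apply: (@le_trans _ _ (\sum_(i < N) leb_outer A)%E); last by apply: lee_sum => i _; exact: FA.
  by rewrite -(fineK Afin) sumEFin sumr_const card_ord -EFinM mulr_natl.
apply/eqP; rewrite eq_le leb_outer_ge0 andbT leNgt; apply/negP => A0.
move: NA A0; rewrite -(fineK Afin) lte_fin; set r := fine _ => NA r0.
have := NA (Num.truncn (box_vol a c / r)).+1.
rewrite -EFinM lee_fin leNgt => /negP; apply.
by rewrite -ltr_pdivrMr// truncnS_gt.
Qed.

(** Cones and 0-homogeneous functions under this finite measure stand for subsets of the sphere and
    functions on it under [sigma], up to the factor n+1. *)
Definition coneM : {finite_measure set T -> \bar R} :=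
  mfrestr measurable_punctured_ball punctured_ball_lty.

Lemma coneME (A : set T) : coneM A = leb_outer (A `&` punctured_ball).
Proof. by []. Qed.

Lemma dotpZ (s t : R) (x y : V) : dotp (s *: x) (t *: y) = s * t * dotp x y.
Proof. by rewrite /dotp mulr_sumr; apply: eq_bigr => i _; rewrite !mxE; ring. Qed.

Lemma dotp_ge0 y : 0 <= dotp y y.
Proof. by apply: sumr_ge0 => i _; rewrite -expr2 sqr_ge0. Qed.

Lemma dotp_eq0 y : (dotp y y == 0) = (y == 0).
Proof.
apply/idP/eqP => [|->]; last by rewrite /dotp big1// => i _; rewrite mxE mul0r.
rewrite psumr_eq0 => [/allP y0|i _]; last by rewrite -expr2 sqr_ge0.
apply/rowP => i; rewrite mxE; apply/eqP; rewrite -sqrf_eq0 expr2.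
by apply: (y0 i); rewrite mem_index_enum.
Qed.

Lemma polar y : 0 < dotp y y -> exists x, sphere x /\ y = Num.sqrt (dotp y y) *: x.
Proof.
move=> y0; have s0 : Num.sqrt (dotp y y) != 0 by rewrite gt_eqF// sqrtr_gt0.
exists ((Num.sqrt (dotp y y))^-1 *: y); split; last by rewrite scalerA mulfV// scale1r.
rewrite /sphere/= dotpZ -invfM -expr2 sqr_sqrtr ?dotp_ge0//.
by rewrite mulVf// gt_eqF.
Qed.

(** Polar coordinates: [W] contains all or nothing of each open ray, and the origin is left
    unconstrained because [coneM] does not see it. *)
Lemma sigma_coneM (w : set V) (W : set T) :
  (forall x t, sphere x -> 0 < t -> W (t *: x : V) <-> w x) ->
  sigma w = ((n.+1)%:R%:E * coneM W)%E.
Proof.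
move=> Ww; rewrite coneME /sigma; congr (_ * leb_outer _)%E.
apply/seteqP; split => [_ [t [x [/andP[t0 t1] [wx [Sx ->]]]]]|y [Wy yD]].
  split; first by apply/(Ww _ _ Sx t0).
  rewrite /punctured_ball/= dotpZ Sx mulr1 mulr_gt0//=.
  by rewrite mulr_ile1// ltW.
have /andP[y0 y1] := yD; have [x [Sx yx]] := polar y0.
have t0 : 0 < Num.sqrt (dotp y y) by rewrite sqrtr_gt0.
exists (Num.sqrt (dotp y y)), x; rewrite t0 /=; split.
  by rewrite -sqrtr1 ler_wsqrtr.
by split => //; apply/(Ww _ _ Sx t0); rewrite -yx.
Qed.

End ConeMeasure.

(** * Layer-cake formula and integrals over the sphere *)

Section LayerCake.
Context d (T : measurableType d) (R : realType).
Variables (m : {finite_measure set T -> \bar R}) (g : T -> R).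
Hypothesis mg : measurable_fun [set: T] g.

Let A : set (T * measurableTypeR R) := [set p | 0 <= p.2 < g p.1].

Let mA : measurable A.
Proof.
have mg1 : measurable_fun [set: T * measurableTypeR R] (fun p => g p.1).
  exact: measurableT_comp.
have m2 : measurable_fun [set: T * measurableTypeR R] (fun p => p.2 : R).
  exact: measurable_snd.
rewrite (_ : A = ([set: _] `&` [set p | 0 <= p.2]) `&`
    ~` ([set: _] `&` [set p | g p.1 <= p.2])).
  apply: measurableI; first exact: measurable_fun_le.
  by apply: measurableC; exact: measurable_fun_le.
apply/seteqP; split => -[y t] /=; rewrite /A/= ltNge.
  by move=> /andP[-> /negP ?]; split => // -[_].
by move=> [[_ ->]] /= tg; apply/negP => ?; exact: tg.
Qed.

Let ysectionA t : 0 <= t -> ysection A t = [set y | t < g y].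
Proof. by move=> t0; apply/seteqP; split => y /=; rewrite ysectionE/= /A/= t0. Qed.

Lemma measurable_tail :
  measurable_fun (`[0%R, +oo[ : set (measurableTypeR R)) (fun t => m [set y | t < g y]).
Proof.
apply: (eq_measurable_fun (m \o ysection A)).
  by move=> t; rewrite inE/= in_itv/= andbT => t0; rewrite ysectionA.
by apply: measurable_funTS; exact: measurable_fun_ysection.
Qed.

(** Tonelli's theorem for the region [A] under the graph: its section at y is the interval [0, g y[,
    of length g y, and its section at t >= 0 is the superlevel set of g. *)
Lemma layer_cake : (forall y, 0 <= g y) ->
  (\int[m]_y (g y)%:E =
   \int[@lebesgue_measure R]_(t in `[0%R, +oo[) m [set y | (t < g y)%R])%E.
Proof.
move=> g0.
have := indic_fubini_tonelli m (@lebesgue_measure R) mA.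
rewrite indic_fubini_tonelli_FE// indic_fubini_tonelli_GE// => FG.
transitivity (\int[m]_x (lebesgue_measure \o xsection A) x)%E.
  apply: eq_integral => y _ /=.
  rewrite (_ : xsection A y = `[0%R, g y[%classic).
    rewrite lebesgue_measure_itv/= lte_fin; have := g0 y; rewrite le_eqVlt => /predU1P[<-|->];
      by rewrite ?ltxx ?sube0.
  by apply/seteqP; split => t /=; rewrite xsectionE/= in_itv.
rewrite FG [RHS]integral_mkcond; apply: eq_integral => t _.
rewrite patchE/=; have [t0|t0] := leP 0 t.
  by rewrite mem_set/= ?in_itv/= ?t0// ysectionA.
rewrite memNset/= ?in_itv/= ?leNgt ?t0//.
rewrite (_ : ysection A t = set0) ?measure0//.
by apply/seteqP; split => y //=; rewrite ysectionE/= /A/= leNgt t0.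
Qed.

End LayerCake.
Section SphereIntegral.
Context (R : realType) (n : nat).
Notation T := (lebT R n).
Notation V := 'rV[R]_(n.+1).
Variables (f : V -> R) (F : T -> R) (M : R).
Hypothesis mF : measurable_fun [set: T] F.
Hypothesis FM : forall y, `|F y| <= M.
Hypothesis Ff : forall (x : V) t, sphere x -> 0 < t -> F (t *: x : V) = f x.

Lemma coneM_integrable : (coneM R n).-integrable [set: T] (EFin \o F).
Proof.
apply: (le_integrable measurableT _ _ (finite_measure_integrable_cst (coneM R n) M measurableT)).
  exact/measurable_EFinP.
by move=> y _ /=; rewrite lee_fin (le_trans (FM y))// ler_norm.
Qed.

(** The layer-cake formula is applied to the positive and the negative part of the 0-homogeneous
    extension [F] of [f], whose level sets are cones. *)
Lemma sphere_integralE :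
  (sphere_integral f = (n.+1)%:R%:E * \int[coneM R n]_y (F y)%:E)%E.
Proof.
have hom (r : set R) : sigma [set x | sphere x /\ r (f x)] =
    ((n.+1)%:R%:E * coneM R n [set y | r (F y)])%E.
  by apply: sigma_coneM => x t Sx t0 /=; rewrite Ff//; split => [|[]].
rewrite integralE funerpos funerneg /sphere_integral.
rewrite !layer_cake; last 4 first.
- exact: measurable_funrneg.
- by move=> y; exact: funrneg_ge0.
- exact: measurable_funrpos.
- by move=> y; exact: funrpos_ge0.
(* Since [F] is bounded, both parts have finite integral; this lets the factor n+1 distribute over
   the difference. *)
have [mp mn] : (\int[@lebesgue_measure R]_(t in `[0%R, +oo[)
      coneM R n [set y | (t < F^\+ y)%R] \is a fin_num)%E /\
   (\int[@lebesgue_measure R]_(t in `[0%R, +oo[)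
      coneM R n [set y | (t < F^\- y)%R] \is a fin_num)%E.
  rewrite -!layer_cake; last 4 first.
  - exact: measurable_funrneg.
  - by move=> y; exact: funrneg_ge0.
  - exact: measurable_funrpos.
  - by move=> y; exact: funrpos_ge0.
  have iF := coneM_integrable; split; apply: integrable_fin_num => //.
    by have := integrable_funepos measurableT iF; rewrite funerpos.
  by have := integrable_funeneg measurableT iF; rewrite funerneg.
rewrite muleBr// ?fin_num_adde_defl//; last by rewrite fin_numN.
congr (_ - _)%E; rewrite -ge0_integralZl//.
- apply: eq_integral => t; rewrite inE/= in_itv/= andbT => t0.
  rewrite (hom (fun r => t < r)); congr (_ * coneM _ _ _)%E.
  by apply/seteqP; split => y /=; rewrite /funrpos lt_max [t < 0]ltNge t0 orbF.
- by apply: measurable_tail; exact: measurable_funrpos.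
- apply: eq_integral => t; rewrite inE/= in_itv/= andbT => t0.
  rewrite (hom (fun r => r < - t)); congr (_ * coneM _ _ _)%E.
  by apply/seteqP; split => y /=; rewrite /funrneg lt_max [t < 0]ltNge t0 orbF ltrNr.
- by apply: measurable_tail; exact: measurable_funrneg.
Qed.

End SphereIntegral.

(** * Support and radial functions of polytopes *)

Section DotProduct.
Context (R : realType) (n : nat).
Notation V := 'rV[R]_(n.+1).
Implicit Types (x y z N : V).

Lemma dotpC x y : dotp x y = dotp y x.
Proof. by apply: eq_bigr => i _; rewrite mulrC. Qed.

Lemma dotpDl x y z : dotp (x + y) z = dotp x z + dotp y z.
Proof. by rewrite -big_split; apply: eq_bigr => i _; rewrite !mxE mulrDl. Qed.

Lemma dotpZl t x y : dotp (t *: x) y = t * dotp x y.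
Proof. by rewrite /dotp mulr_sumr; apply: eq_bigr => i _; rewrite !mxE mulrA. Qed.

Lemma dotpZr t x y : dotp x (t *: y) = t * dotp x y.
Proof. by rewrite dotpC dotpZl dotpC. Qed.

Lemma dotpDr x y z : dotp x (y + z) = dotp x y + dotp x z.
Proof. by rewrite dotpC dotpDl !(dotpC x). Qed.

Lemma dotp0l x : dotp 0 x = 0.
Proof. by rewrite -(scale0r x) dotpZl mul0r. Qed.

Lemma dotpBl x y z : dotp (x - y) z = dotp x z - dotp y z.
Proof. by rewrite dotpDl -scaleN1r dotpZl mulN1r. Qed.

Lemma dotp_suml m (l : 'I_m -> R) (v : 'I_m -> V) y :
  dotp (\sum_j l j *: v j) y = \sum_j l j * dotp (v j) y.
Proof.
elim/big_ind2 : _ => [|a b c d <- <-|j _]; first exact: dotp0l.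
  exact: dotpDl.
exact: dotpZl.
Qed.

(** The norm here is the sup norm, which the Euclidean norm dominates; hence only an inequality. *)
Lemma sphere_norm_le1 x : sphere x -> `|x| <= 1.
Proof.
move=> Sx; rewrite [leLHS]/Num.norm/= mx_normrE; apply: bigmax_le => // -[i j] _ /=.
rewrite ord1 -(@expr_le1 _ 2)// real_normK ?num_real// -[leRHS]Sx.
exact: sqr_coord_le_sqnorm.
Qed.

End DotProduct.

Section ConvexHull.
Context (R : realType) (n m : nat) (v : 'I_m -> 'rV[R]_(n.+1)).
Notation V := 'rV[R]_(n.+1).
Notation C := (conv_hull v).

Lemma conv_hull_vertex j : C (v j).
Proof.
exists (fun i => (i == j)%:R); split=> [i|]; first by rewrite ler0n.
by split; rewrite (bigD1 j)//= eqxx big1 ?addr0 ?scale1r// => i /negPf ->; rewrite ?scale0r.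
Qed.

Lemma conv_hull_le (f : V -> R) M y :
  (forall (l : 'I_m -> R), (forall j, 0 <= l j) -> \sum_j l j = 1 ->
     f (\sum_j l j *: v j) <= \sum_j l j * f (v j)) ->
  (forall j, f (v j) <= M) -> C y -> f y <= M.
Proof.
move=> fcvx fM [l [l0 [l1 ->]]]; apply: le_trans (fcvx l l0 l1) _.
rewrite -[leRHS]mul1r -l1 mulr_suml; apply: ler_sum => j _.
exact: ler_wpM2l.
Qed.

(* Among the v j maximizing the linear functional, one of maximal norm is an
   extreme point, by strict convexity of the square of the norm. *)
Lemma conv_hull_linear_max (N : V) : C !=set0 ->
  exists2 w, vertex C w & forall y, C y -> dotp y N <= dotp w N.
Proof.
move=> [y0 [l0 [_ [l1 _]]]].
have j0 : 'I_m.
  case: m v l0 l1 => [v' l' |m' _ _ _]; last exact: ord0.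
  by rewrite big_ord0 => /esym/eqP; rewrite oner_eq0.
have [j1 _ j1max] := @arg_maxP _ _ _ j0 xpredT (fun j => dotp (v j) N) isT.
have {}j1max j : dotp (v j) N <= dotp (v j1) N by exact: j1max.
have CN y : C y -> dotp y N <= dotp (v j1) N.
  apply: (conv_hull_le (f := fun y => dotp y N)) => [l _ _|j].
    by rewrite dotp_suml.
  exact: j1max.
have [j2 j2N j2max] := @arg_maxP _ _ _ j1 (fun j => dotp (v j) N == dotp (v j1) N)
  (fun j => dotp (v j) (v j)) (eqxx _).
have {}j2max j : dotp (v j) N = dotp (v j1) N -> dotp (v j) (v j) <= dotp (v j2) (v j2).
  by move=> /eqP; exact: j2max.
exists (v j2); last by rewrite (eqP j2N).
split; first exact: conv_hull_vertex.
have face y : C y -> dotp y N = dotp (v j1) N -> dotp y y <= dotp (v j2) (v j2).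
  move=> [l [lge0 [suml ->]]]; rewrite dotp_suml => lN.
  have lface j : l j * dotp (v j) (v j) <= l j * dotp (v j2) (v j2).
    have [->|lj0] := eqVneq (l j) 0; first by rewrite !mul0r.
    apply: ler_wpM2l => //; apply: j2max; apply/esym.
    (* A vanishing sum of nonnegative terms: every generator of nonzero weight lies in the face
       where the maximum is attained. *)
    have : \sum_i l i * (dotp (v j1) N - dotp (v i) N) == 0.
      under eq_bigr do rewrite mulrBr.
      by rewrite sumrB lN -mulr_suml suml mul1r subrr.
    rewrite psumr_eq0 => [/allP/(_ j)|i _]; last by rewrite mulr_ge0// subr_ge0 j1max.
    rewrite mem_index_enum => /(_ isT); rewrite mulf_eq0 (negbTE lj0) subr_eq0.
    by move=> /eqP.
  set w := \sum_i _; apply: le_trans (_ : \sum_j l j * dotp (v j) (v j) <= _); last first.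
    by rewrite -[leRHS]mul1r -suml mulr_suml; apply: ler_sum => j _.
  (* Nonnegativity of the variance about the barycentre [w] is the convexity of the squared norm. *)
  have : \sum_j l j * dotp (v j - w) (v j - w) >= 0.
    by apply: sumr_ge0 => j _; rewrite mulr_ge0// dotp_ge0.
  have -> : \sum_j l j * dotp (v j - w) (v j - w) =
     \sum_j l j * dotp (v j) (v j) - 2 * (\sum_j l j * dotp (v j) w) + (\sum_j l j) * dotp w w.
    rewrite mulr_sumr mulr_suml -sumrB -big_split/=; apply: eq_bigr => j _.
    rewrite !dotpBl ![dotp _ (v j - w)]dotpC !dotpBl (dotpC w (v j)); ring.
  by rewrite suml -dotp_suml -/w; lra.
move=> y z t Cy Cz /andP[t0 t1] vyz.
have [yN zN] : dotp y N = dotp (v j1) N /\ dotp z N = dotp (v j1) N.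
  have := CN _ Cy; have := CN _ Cz; have := eqP j2N; rewrite vyz dotpDl !dotpZl.
  move: (dotp y N) (dotp z N) (dotp _ N) => a b c; nra.
have ny := face _ Cy yN; have nz := face _ Cz zN.
apply/eqP; rewrite -subr_eq0 -dotp_eq0 eq_le dotp_ge0 andbT.
have E : dotp (y - z) (y - z) = dotp y y - 2 * dotp y z + dotp z z.
  by rewrite dotpBl ![dotp _ (y - z)]dotpC !dotpBl (dotpC z y); ring.
(* Neither endpoint has larger norm than [v j2], so the defect t (1 - t) |y - z|^2 has to vanish. *)
have E2 : dotp (v j2) (v j2) =
    t * dotp y y + (1 - t) * dotp z z - (t * (1 - t)) * dotp (y - z) (y - z).
  by rewrite E vyz !(dotpDl, dotpDr, dotpZl, dotpZr) (dotpC z y); ring.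
have t1' : 0 < 1 - t by rewrite subr_gt0.
rewrite -(pmulr_rle0 _ (mulr_gt0 t0 t1')).
have := ler_wpM2l (ltW t0) ny; have := ler_wpM2l (ltW t1') nz; rewrite E2; lra.
Qed.

End ConvexHull.

(** * Radial and support functions of convex bodies *)

Section ConvexBody.
Context (R : realType) (n : nat).
Notation V := 'rV[R]_(n.+1).
Variable C : set V.
Hypothesis bodyC : convex_body C.
Implicit Types (x y z N : V).

Let compC : compact C := bodyC.1.
Let convC : Defs.convex_set C := bodyC.2.1.
Let closedC : closed C := compact_closed (@norm_hausdorff _ _) compC.

Lemma convex_body_ball : exists2 e : R, 0 < e & forall y, `|y| < e -> C y.
Proof. by have /nbhs_norm0P[e /= e0 eC] := bodyC.2.2; exists e. Qed.

Lemma convex_body0 : C 0.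
Proof. by have [e e0] := convex_body_ball; apply; rewrite normr0. Qed.

(** If C contains the ball of radius e about 0, convexity puts t y + (1 - t) z in C for all z in
    that ball, that is, the ball of radius (1 - t) e about t y. *)
Lemma interior_convex_body t y : 0 <= t < 1 -> C y -> C° (t *: y).
Proof.
move=> /andP[t0 t1] Cy; have [e e0 eC] := convex_body_ball.
have s0 : 0 < 1 - t by rewrite subr_gt0.
apply: (nbhs_normP (t *: y) C).2; exists ((1 - t) * e) => /=; first exact: mulr_gt0.
move=> z /= tyz.
rewrite (_ : z = t *: y + (1 - t) *: ((1 - t)^-1 *: (z - t *: y))).
  apply: convC => //; last by rewrite t0 ltW.
  apply: eC; rewrite normrZ gtr0_norm ?invr_gt0// mulrC ltr_pdivrMr// mulrC.
  by rewrite distrC.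
by rewrite scalerA divff ?gt_eqF// scale1r addrC subrK.
Qed.

Lemma boundary_convex_body y : boundary C y -> C y.
Proof. by move=> [/closedC]. Qed.

(** Let r be the supremum of the t > 0 with t x in C. By [interior_convex_body] every t x with 0 <=
    t < r is interior, so r x is the only boundary point on the open ray and the supremum in
    [radial] is over a singleton. *)
Lemma radialP x : sphere x ->
  [/\ 0 < radial (boundary C) x, boundary C (radial (boundary C) x *: x) &
      forall t, C (t *: x) -> t <= radial (boundary C) x].
Proof.
move=> Sx.
have x0 : 0 < `|x|.
  rewrite normr_gt0 -dotp_eq0; have -> : dotp x x = 1 by [].
  exact: oner_neq0.
pose A := [set t | 0 < t /\ C (t *: x)].
have [e e0 eC] := convex_body_ball.
have Ae : A (e / 2).
  split; first by rewrite divr_gt0.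
  apply: eC; rewrite normrZ gtr0_norm ?divr_gt0//.
  by have := sphere_norm_le1 Sx; nra.
have [M CM] : exists M, forall t, C (t *: x) -> t <= M.
  have [M [_ /(_ _ (ltr_pwDr ltr01 (lexx M))) CM]] := compact_bounded compC.
  exists ((M + 1) / `|x|) => t /CM /=; rewrite normrZ ler_pdivlMr//; apply: le_trans.
  by rewrite ler_pM2r// ler_norm.
have ubA : has_ubound A by exists M => t [_ /CM].
set r := sup A.
have r0 : 0 < r by apply: lt_le_trans (ub_le_sup ubA Ae); rewrite divr_gt0.
have Cr t : C (t *: x) -> t <= r.
  move=> Ct; have [t0|t0] := leP t 0; first exact: le_trans t0 (ltW r0).
  by apply: ub_le_sup.
have ltC t : 0 <= t < r -> C° (t *: x).
  move=> /andP[t0 tr].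
  have [s [s0 Cs]] : exists2 s, A s & t < s.
    have [|s As] := @sup_adherent _ A (r - t) _ (conj (ex_intro _ _ Ae) ubA).
      by rewrite subr_gt0.
    by rewrite subKr => ts; exists s.
  move=> ts; rewrite (_ : t *: x = (t / s) *: (s *: x)).
    by apply: interior_convex_body => //; rewrite divr_ge0 ?(ltW s0)//= ltr_pdivrMr// mul1r.
  by rewrite scalerA divfK// gt_eqF.
have clr : closure C (r *: x).
  (* This [s] is positive and below both [r] and [e'], so (r - s) x belongs to C and to the given
     neighbourhood of r x. *)
  move=> B /(nbhs_normP (r *: x) B).1[e' /= e'0 e'B]; pose s := Num.min r e' / 2.
  have [s0 sr se] : [/\ 0 < s, s < r & s < e'].
    by rewrite /s /Num.min; case: ifPn => [?|]; rewrite -?leNgt => *; split; lra.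
  exists ((r - s) *: x); split.
    by apply: (interior_subset (ltC _ _)); apply/andP; split; lra.
  apply: e'B; rewrite /= -scalerBl subKr normrZ gtr0_norm//.
  by have := sphere_norm_le1 Sx; nra.
have nintr : ~ C° (r *: x).
  move=> /(nbhs_normP (r *: x) C).1[e' /= e'0 e'B].
  suff /e'B/Cr : ball_ Num.norm (r *: x) e' ((r + e' / 2) *: x) by lra.
  rewrite /ball_/= -scalerBl normrZ opprD addNKr normrN gtr0_norm ?divr_gt0//.
  by have := sphere_norm_le1 Sx; nra.
have bd t : 0 < t -> boundary C (t *: x) -> t = r.
  move=> t0 [/closedC/Cr]; rewrite le_eqVlt => /predU1P[//|tr] nint.
  by exfalso; apply: nint; apply: ltC; rewrite (ltW t0).
have -> : radial (boundary C) x = r.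
  rewrite /radial (_ : [set _ | _] = [set r]) ?sup1//.
  by apply/seteqP; split => t /= => [[t0 /(bd _ t0)]|->].
by split.
Qed.

Lemma supportf_eq N x : sphere x ->
   (forall z, C z -> dotp z N <= radial (boundary C) x * dotp x N) ->
  supportf (boundary C) N = radial (boundary C) x * dotp x N.
Proof.
move=> Sx xmax; rewrite /supportf; set A := [set _ | _ in _].
have ubA : ubound A (radial (boundary C) x * dotp x N).
  move=> _ [z Sz <-]; have [_ /boundary_convex_body/xmax + _] := radialP Sz.
  by rewrite dotpZl.
apply/eqP; rewrite eq_le; apply/andP; split.
  by apply: ge_sup => //; eexists; exists x.
by apply: ub_le_sup; [eexists; exact: ubA|exists x].
Qed.

End ConvexBody.

Section Polytope.
Context (R : realType) (n K : nat) (x : 'I_K -> 'rV[R]_(n.+1)).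
Notation V := 'rV[R]_(n.+1).
Implicit Types (p : 'I_K -> R) (y N : V).

(** The function h_p, defined on the whole space. When p is positive and the points lie in no closed
    hemisphere, some term is positive at each nonzero y, so the initial value 0 does not affect the
    maximum there. *)
Definition maxdot p y : R := \big[Num.max/0]_(j < K) (p j * dotp (x j) y).

Lemma maxdot_le p y M : 0 <= M -> (forall j, p j * dotp (x j) y <= M) ->
  maxdot p y <= M.
Proof. by move=> M0 pM; apply: bigmax_le. Qed.

Lemma le_maxdot p y j : p j * dotp (x j) y <= maxdot p y.
Proof. exact: (le_bigmax 0 (fun j => p j * dotp (x j) y)). Qed.

Hypothesis Sx : forall j, sphere (x j).
Variable P : set V.
Hypothesis FP : in_FKn x P.
Notation rho j := (radial P (x j)).

Lemma radial_gt0 j : 0 < rho j.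
Proof.
by have [m [v [bodyC [-> _]]]] := FP; have [] := radialP bodyC (Sx j).
Qed.

(** The maximum of the functional over the polytope is attained at a vertex t x_j. It is nonnegative
    because 0 lies in the polytope, so pushing the vertex out to rho_j x_j cannot decrease it. *)
Lemma polytope_linear_max N : exists j,
  [/\ supportf P N = rho j * dotp (x j) N, 0 <= rho j * dotp (x j) N,
     forall y, P y -> dotp y N <= rho j * dotp (x j) N &
     forall i, rho i * dotp (x i) N <= rho j * dotp (x j) N].
Proof.
have [m [v [bodyC [PE vtx]]]] := FP; have C0 := convex_body0 bodyC.
have [w wvtx wmax] := conv_hull_linear_max N (ex_intro _ _ C0).
have [j [t [t0 wE]]] := vtx w wvtx; exists j.
have [r0 bdr rmax] := radialP bodyC (Sx j); rewrite -PE in r0 bdr rmax.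
have tr : t <= rho j by apply: rmax; rewrite -wE; exact: wvtx.1.
have d0 : 0 <= dotp (x j) N.
  by have := wmax _ C0; rewrite dotp0l wE dotpZl pmulr_rge0.
have Cmax y : conv_hull v y -> dotp y N <= rho j * dotp (x j) N.
  by move=> /wmax; rewrite wE dotpZl => /le_trans; apply; exact: ler_wpM2r.
split.
- by rewrite PE; apply: supportf_eq => // z; rewrite -PE; exact: Cmax.
- by rewrite mulr_ge0// ltW.
- by move=> y; rewrite {1}PE => /(boundary_convex_body bodyC)/Cmax.
- move=> i; have [_ /(boundary_convex_body bodyC) + _] := radialP bodyC (Sx i).
  by rewrite -PE => /Cmax; rewrite dotpZl.
Qed.

Lemma supportf_maxdot N : supportf P N = maxdot (fun j => rho j) N.
Proof.
have [j [-> j0 _ jmax]] := polytope_linear_max N.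
by apply/eqP; rewrite eq_le (le_maxdot (fun j => rho j))/= maxdot_le.
Qed.

(** A hyperplane through rho_i x_i supports the polytope as soon as no point rho_j x_j lies beyond
    it, by [polytope_linear_max]. *)
Lemma gauss_mapE i : gauss_map P (x i) =
  [set N | sphere N /\ forall j, rho j * dotp (x j) N <= rho i * dotp (x i) N].
Proof.
apply/seteqP; split => N /= [SN Ni]; split => //.
  move=> j; rewrite -!dotpZl; apply: (Ni (rho j *: x j)).
  by have [m [v [bodyC [-> _]]]] := FP; have [] := radialP bodyC (Sx j).
move=> y Py; have [j [_ _ jmax _]] := polytope_linear_max N.
by rewrite dotpZl; apply: le_trans (jmax _ Py) (Ni j).
Qed.

(** The polytope contains a ball about 0, hence the points (e / 2) N. The uniform bound keeps the
    logarithm of the support function bounded below, as integrability requires. *)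
Lemma supportf_lbound : exists2 e, 0 < e & forall N, sphere N -> e <= supportf P N.
Proof.
have [m [v [bodyC [PE _]]]] := FP; have [e e0 eC] := convex_body_ball bodyC.
exists (e / 2) => [|N SN]; first by rewrite divr_gt0.
have [j [-> _ jmax _]] := polytope_linear_max N.
have CN : conv_hull v ((e / 2) *: N).
  apply: eC; rewrite normrZ gtr0_norm ?divr_gt0//.
  by have := sphere_norm_le1 SN; nra.
have [r0 bdr rmax] := radialP bodyC SN; rewrite -PE in bdr rmax.
have := jmax _ bdr; rewrite dotpZl SN mulr1 => /(le_trans _); apply.
exact: rmax.
Qed.

End Polytope.

(** * Variation of the functional *)

Section MaxDot.
Context (R : realType) (n K : nat) (x : 'I_K -> 'rV[R]_(n.+1)).
Notation V := 'rV[R]_(n.+1).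
Notation T := (lebT R n).
Implicit Types (p q : 'I_K -> R) (y N : V).
Notation maxdot := (maxdot x).

Lemma maxdot_ge0 p y : 0 <= maxdot p y.
Proof. exact: bigmax_ge_id. Qed.

Lemma maxdotZ p t y : 0 < t -> maxdot p (t *: y) = t * maxdot p y.
Proof.
have le s z : 0 < s -> maxdot p (s *: z) <= s * maxdot p z.
  move=> s0; apply: maxdot_le => [|j]; first by rewrite mulr_ge0 ?maxdot_ge0 ?ltW.
  by rewrite dotpZr mulrCA ler_pM2l// le_maxdot.
move=> t0; apply/eqP; rewrite eq_le le//=.
rewrite -ler_pdivlMl//; apply: le_trans (le _ _ _); last by rewrite invr_gt0.
by rewrite scalerA mulVf ?gt_eqF// scale1r.
Qed.

Lemma measurable_maxdot p : measurable_fun [set: T] (maxdot p).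
Proof.
rewrite /maxdot; elim: (index_enum _) => [|j s IH].
  by under eq_fun do [rewrite big_nil]; exact: measurable_cst.
under eq_fun do rewrite big_cons; apply: measurable_maxr => //.
by apply: measurable_funM => //; exact: measurable_dotp.
Qed.

Lemma continuous_dotp b : continuous (fun y : V => dotp b y).
Proof.
move=> y; apply: (@cvg_big _ _ _ _ _ _ _ (nbhs y)) => [|i _]; first exact: add_continuous.
by apply: cvgM; [exact: cvg_cst|exact: coord_continuous].
Qed.

Lemma continuous_maxdot p : continuous (maxdot p : V -> R).
Proof.
move=> y; apply: (@cvg_big _ _ _ _ _ _ _ (nbhs y)) => [z|j _].
  by apply: continuous_max; [exact: cvg_fst|exact: cvg_snd].
by apply: cvgM; [exact: cvg_cst|exact: continuous_dotp].
Qed.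

Hypothesis Sx : forall j, sphere (x j).
Hypothesis nohemi : forall N, sphere N -> exists i, dotp (x i) N < 0.

Lemma maxdot_gt0 p N : (forall j, 0 < p j) -> sphere N -> 0 < maxdot p N.
Proof.
move=> p0 SN; have SoN : sphere (- N) by rewrite /sphere/= -scaleN1r dotpZ SN; ring.
have [j] := nohemi SoN; rewrite -scaleN1r dotpZr mulN1r oppr_lt0 => jN.
by apply: lt_le_trans (le_maxdot x p N j); rewrite mulr_gt0.
Qed.

Lemma in_AK_maxdot p : (forall j, 0 < p j) -> in_AK x (maxdot p) p.
Proof.
move=> p0; split; last split; last split => //.
- by apply: continuous_subspaceT => y; exact: continuous_maxdot.
- by move=> N; exact: maxdot_gt0.
move=> i N SN d0; rewrite lerBrDr -lnM ?posrE//.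
by rewrite ler_ln ?posrE ?mulr_gt0 ?maxdot_gt0// mulrC le_maxdot.
Qed.

(* The 0-homogeneous extension of ln (maxdot p) from the sphere. *)
Definition lnmaxdot p : T -> R := fun y : V => ln (maxdot p y) - ln (dotp y y) / 2.

Lemma lnmaxdotE p y t : (forall j, 0 < p j) -> sphere y -> 0 < t ->
  lnmaxdot p (t *: y : V) = ln (maxdot p y).
Proof.
move=> p0 Sy t0; rewrite /lnmaxdot maxdotZ// dotpZ Sy mulr1.
rewrite !lnM ?posrE ?maxdot_gt0//; lra.
Qed.

Lemma measurable_lnmaxdot p : measurable_fun [set: T] (lnmaxdot p).
Proof.
apply: measurable_funB.
  by apply: (measurableT_comp (@measurable_ln R)); exact: measurable_maxdot.
apply: measurable_funM => //; apply: (measurableT_comp (@measurable_ln R)).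
exact: measurable_sqnorm.
Qed.

Lemma lnmaxdot_bounded p e : (forall j, 0 < p j) -> 0 < e ->
  (forall N, sphere N -> e <= maxdot p N) ->
  exists M, forall y : T, `|lnmaxdot p y| <= M.
Proof.
move=> p0 e0 pe.
(* The first term covers the origin, where homogeneity says nothing; the other two come from the
   bounds e and sum p_j on the sphere. *)
exists (`|lnmaxdot p (0 : V)| + (`|ln e| + `|ln (\sum_j p j)|)) => y.
have [->|y0] := eqVneq (y : V) 0; first by rewrite lerDl addr_ge0.
have [|N [SN ->]] := @polar _ _ (y : V); first by rewrite lt_neqAle eq_sym dotp_eq0 y0 dotp_ge0.
rewrite lnmaxdotE//; last by rewrite sqrtr_gt0 lt_neqAle eq_sym dotp_eq0 y0 dotp_ge0.
have M0 := maxdot_gt0 p0 SN.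
have Mp : maxdot p N <= \sum_j p j.
  apply: maxdot_le => [|j]; first by apply: sumr_ge0 => j _; exact: ltW.
  rewrite (bigD1 j)//=; apply: le_trans (_ : p j <= _); last first.
    by rewrite lerDl sumr_ge0// => i _; exact: ltW.
  apply: ler_piMr; first exact: ltW.
  (* Expanding |x_j - N|^2 >= 0 for unit vectors gives <x_j, N> <= 1. *)
  have := dotp_ge0 (x j - N); rewrite dotpBl ![dotp _ (x j - N)]dotpC !dotpBl.
  rewrite (dotpC N) Sx SN ; lra.
have l1 : ln e <= ln (maxdot p N) by rewrite ler_ln ?posrE// pe.
have l2 : ln (maxdot p N) <= ln (\sum_j p j).
  by rewrite ler_ln ?posrE//; apply: lt_le_trans Mp.
have := normr_ge0 (lnmaxdot p (0 : V)); have := ler_norm (- ln e).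
have := ler_norm (ln (\sum_j p j)); rewrite normrN ler_norml.
have := normr_ge0 (ln e); have := normr_ge0 (ln (\sum_j p j)); lra.
Qed.

End MaxDot.

Lemma le_integral_indic d (T : measurableType d) (R : realType)
    (m : {finite_measure set T -> \bar R}) (f g : T -> R) (s : R) (B : set T) :
  measurable B -> m.-integrable [set: T] (EFin \o f) ->
  m.-integrable [set: T] (EFin \o g) -> (forall y, g y <= f y + s * \1_B y) ->
  fine (\int[m]_y (g y)%:E) <= fine (\int[m]_y (f y)%:E) + s * fine (m B).
Proof.
move=> mB fi gi gf.
have si : m.-integrable [set: T] (fun y => (s%:E * (\1_B y)%:E)%E).
  by apply: integrableZl => //; exact: integrable_indic.
have mBfin : m B \is a fin_num by exact: fin_num_measure.
have fif := integrable_fin_num measurableT fi.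
have gif := integrable_fin_num measurableT gi.
rewrite -lee_fin EFinD EFinM !fineK//.
apply: (@le_trans _ _ (\int[m]_y ((f y)%:E + s%:E * (\1_B y)%:E))%E).
  apply: le_integral => //; first exact: integrableD.
  by move=> y _; rewrite -EFinM -EFinD lee_fin.
rewrite integralD// integralZl//; last exact: integrable_indic.
by rewrite integral_indic// setIT.
Qed.

(** * Cones where one term of the maximum dominates *)

Section Dominance.
Context (R : realType) (n K : nat) (x : 'I_K -> 'rV[R]_(n.+1)).
Notation V := 'rV[R]_(n.+1).
Notation T := (lebT R n).
Implicit Types (y : V) (c s : R).
Variables (p : 'I_K -> R) (i : 'I_K).
Hypothesis Sx : forall j, sphere (x j).
Hypothesis xinj : injective x.
Hypothesis nohemi : forall N, sphere N -> exists i, dotp (x i) N < 0.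
Hypothesis p0 : forall j, 0 < p j.

(** The cone over B(c). Positivity of [maxdot] excludes the origin, where all the inequalities hold,
    and for c > 0 it forces the i-th term to be positive. *)
Definition dominance c : set T := [set y : V | 0 < maxdot x p y /\
  forall j, j != i -> p j * dotp (x j) y <= c * (p i * dotp (x i) y)].

Definition scale_at s (j : 'I_K) : R := if j == i then expR s * p j else p j.

Lemma scale_at_gt0 s j : 0 < scale_at s j.
Proof. by rewrite /scale_at; case: ifP => // _; rewrite mulr_gt0 ?expR_gt0. Qed.

Lemma measurable_dominance c : measurable (dominance c).
Proof.
have mterm j : measurable_fun [set: T] (fun y : T => p j * dotp (x j) (y : V)).
  by apply: measurable_funM => //; exact: measurable_dotp.
rewrite (_ : dominance c = ~` ([set: T] `&` [set y | maxdot x p y <= 0]) `&`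
    \bigcap_(j in [set j | j != i])
      ([set: T] `&` [set y : T | p j * dotp (x j) (y : V) <= c * (p i * dotp (x i) (y : V))])).
  apply: measurableI.
    by apply: measurableC; apply: measurable_fun_le => //; exact: measurable_maxdot.
  apply: fin_bigcap_measurable => [|j _]; first exact: finite_finset.
  by apply: measurable_fun_le => //; apply: measurable_funM.
apply/seteqP; split => y /= [y0 yj]; split.
- by move=> [_]; rewrite leNgt y0.
- by move=> j /yj ?; split.
- by rewrite ltNge; apply/negP => ?; apply: y0.
- by move=> j /yj [].
Qed.

Lemma dominance_gt0 c y : 0 < c -> dominance c y -> 0 < p i * dotp (x i) y.
Proof.
move=> c0 [y0 yj]; rewrite ltNge; apply/negP => pi0; move: y0; rewrite ltNge => /negP; apply.
apply: maxdot_le => // j; have [->//|/yj/le_trans] := eqVneq j i; apply.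
by rewrite pmulr_rle0.
Qed.

Lemma dominance_le c c' : 0 < c -> c <= c' -> dominance c `<=` dominance c'.
Proof.
move=> c0 cc' y Dy; have y0 := dominance_gt0 c0 Dy; have [M0 yj] := Dy.
by split => // j /yj /le_trans; apply; rewrite ler_pM2r.
Qed.

Lemma lnmaxdot_scale_at s (y : T) :
  lnmaxdot x (scale_at s) y <= lnmaxdot x p y + s * \1_(dominance (expR s)) y.
Proof.
(* At the origin every [maxdot] vanishes and the indicator is 0, so both sides agree. *)
have [->|y0] := eqVneq (y : V) 0.
  have M0 q : maxdot x q (0 : V) = 0.
    apply/eqP; rewrite eq_le maxdot_ge0 andbT; apply: maxdot_le => // j.
    by rewrite dotpC dotp0l mulr0.
  rewrite /lnmaxdot !M0 indicE memNset ?mulr0 ?addr0//.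
  by rewrite /dominance/= M0 ltxx => -[].
have gt0 q : (forall j, 0 < q j) -> 0 < maxdot x q y.
  move=> q0; have [|N [SN ->]] := @polar _ _ (y : V).
    by rewrite lt_neqAle eq_sym dotp_eq0 y0 dotp_ge0.
  rewrite maxdotZ ?mulr_gt0 ?maxdot_gt0// sqrtr_gt0.
    by rewrite lt_neqAle eq_sym dotp_eq0 y0 dotp_ge0.
  by rewrite lt_neqAle eq_sym dotp_eq0 y0 dotp_ge0.
have M0 := gt0 _ p0; have Ms := gt0 _ (scale_at_gt0 s).
rewrite /lnmaxdot addrAC lerD2r indicE.
have [Dy|Dy] := pselect (dominance (expR s) y).
  rewrite mem_set//= mulr1 -[s in leRHS]expRK addrC -lnM ?posrE ?expR_gt0//.
  rewrite ler_ln ?posrE ?mulr_gt0 ?expR_gt0//.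
  apply: maxdot_le => [|j]; first by rewrite mulr_ge0 ?expR_ge0 ?ltW.
  rewrite /scale_at; case: eqVneq => [->|/(Dy.2)/le_trans].
    by rewrite -mulrA ler_pM2l ?expR_gt0// le_maxdot.
  by apply; rewrite ler_pM2l ?expR_gt0// le_maxdot.
rewrite memNset//= mulr0 addr0 ler_ln ?posrE//; apply: maxdot_le => [|j]; first exact: ltW.
rewrite /scale_at; case: eqVneq => [->|_]; last exact: le_maxdot.
(* If the rescaled i-th term exceeded [maxdot x p y], it would exceed all the other terms, and y
   would be in the cone. *)
rewrite -mulrA leNgt; apply/negP => lti; apply: Dy; split => // k _.
by apply: le_trans (le_maxdot _ _ _ _) (ltW lti).
Qed.

Lemma exists_invS (e : R) : 0 < e -> exists k : nat, k.+1%:R^-1 < e.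
Proof.
move=> e0; exists (Num.truncn e^-1); rewrite -[ltRHS]invrK ltf_pV2 ?posrE ?invr_gt0//.
exact: truncnS_gt.
Qed.

(** If term j exceeds term i, with values b > a > 0, then y leaves the k-th cone as soon as 1/(k+1)
    < ln (b / a). *)
Lemma bigcap_dominance :
  \bigcap_k dominance (expR k.+1%:R^-1) = dominance 1.
Proof.
apply/seteqP; split => [y Dy|y Dy k _]; last first.
  by apply: dominance_le Dy => //; rewrite -expR0 ler_expR invr_ge0.
have y0 := dominance_gt0 (expR_gt0 _) (Dy 0%N I).
split => [|j ji]; first exact: (Dy 0%N I).1.
rewrite mul1r leNgt; apply/negP => lt.
set a := p i * _ in y0 lt; set b := p j * _ in lt.
have ab : 1 < b / a by rewrite ltr_pdivlMr// mul1r.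
have [k] := exists_invS (ln_gt0 ab); rewrite -ltr_expR lnK ?posrE; last exact: lt_trans ab.
by apply/negP; rewrite -leNgt ler_pdivrMr//; exact: (Dy k I).2.
Qed.

(** Either another term ties with the i-th, and y lies on a hyperplane, or the finitely many other
    terms stay strictly below it, and their maximum leaves room for a factor c < 1. *)
Lemma dominance1_sub :
  dominance 1 `<=` (\bigcup_k dominance (expR (- k.+1%:R^-1))) `|`
    \big[setU/set0]_(j in predC1 i) [set y : V | dotp (p j *: x j - p i *: x i) y = 0].
Proof.
move=> y Dy; have y0 := dominance_gt0 ltr01 Dy; rewrite -bigcup_pred.
have [[j [ji eqj]]|neq] := pselect (exists j, j != i /\ p j * dotp (x j) y = p i * dotp (x i) y).
  by right; exists j => //=; rewrite dotpBl !dotpZl eqj subrr.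
left; set b := p i * _ in y0 neq *.
(* The initial value b / 2 keeps [a] positive, so that b / a makes sense, and still below [b]. *)
pose a := \big[Num.max/b / 2]_(j < K | j != i) (p j * dotp (x j) y).
have ab : a < b.
  apply: bigmax_lt => [|j ji]; first by lra.
  rewrite lt_neqAle; apply/andP; split; first by apply/eqP => eqj; apply: neq; exists j.
  by have := Dy.2 j ji; rewrite mul1r.
have a0 : 0 < a by apply: lt_le_trans (bigmax_ge_id _ _ _ _); rewrite divr_gt0.
have ba : 1 < b / a by rewrite ltr_pdivlMr// mul1r.
have [k] := exists_invS (ln_gt0 ba); rewrite -ltr_expR lnK ?posrE; last exact: lt_trans ba.
move=> kba; exists k => //; split => [|j ji]; first exact: Dy.1.
apply: (@le_trans _ _ a); first exact: (le_bigmax_cond (b / 2) (fun j => p j * dotp (x j) y) ji).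
by rewrite expRN ler_pdivlMl ?expR_gt0// -ler_pdivlMr// ltW.
Qed.

(** The normal vector is nonzero: p_j x_j = p_i x_i would give p_j = p_i on comparing lengths, and
    then x_j = x_i. *)
Lemma coneM_hyperplane j : j != i ->
  coneM R n [set y : V | dotp (p j *: x j - p i *: x i) y = 0] = 0%E.
Proof.
move=> ji; rewrite coneME; apply: leb_outer_hyperplane; apply: contra ji => /eqP.
move=> /subr0_eq px; have : p j ^+ 2 = p i ^+ 2.
  have : dotp (p j *: x j) (p j *: x j) = dotp (p i *: x i) (p i *: x i) by rewrite px.
  by rewrite !dotpZ !Sx !mulr1.
move=> /eqP; rewrite eqrXn2 ?ltW// => /eqP pp; apply/eqP/xinj.
by move: px; rewrite pp => /scalerI; apply; rewrite gt_eqF.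
Qed.

End Dominance.

(** * First variation at the minimizer and passage to the limit *)

Section Minimizer.
Context (R : realType) (n K : nat) (x : 'I_K -> 'rV[R]_(n.+1)) (mu : 'I_K -> R).
Notation V := 'rV[R]_(n.+1).
Variable P : set V.
Hypothesis Sx : forall j, sphere (x j).
Hypothesis xinj : injective x.
Hypothesis nohemi : forall N, sphere N -> exists i, dotp (x i) N < 0.
Hypothesis FP : in_FKn x P.
Hypothesis Pmin : forall h p, in_AK x h p ->
  (QK mu (supportf P) (fun i => radial P (x i)) <= QK mu h p)%E.

Let p j := radial P (x j).
Let p0 j : 0 < p j := radial_gt0 Sx FP j.
Notation lnint q := (\int[coneM R n]_y (lnmaxdot x q y)%:E)%E.

(** The lower bound [e] makes the logarithm bounded, hence integrable, so the functional takes a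
    real value and the comparison becomes real arithmetic. *)
Lemma QK_maxdot q e : (forall j, 0 < q j) -> 0 < e ->
  (forall N, sphere N -> e <= maxdot x q N) ->
  (coneM R n).-integrable [set: lebT R n] (EFin \o lnmaxdot x q) /\
  QK mu (maxdot x q) q =
    ((n.+1)%:R * fine (lnint q) - \sum_j mu j * ln (q j))%:E.
Proof.
move=> q0 e0 qe; have [M qM] := lnmaxdot_bounded Sx nohemi q0 e0 qe.
have mq := measurable_lnmaxdot x q.
have iq := coneM_integrable mq qM; split => //.
rewrite /QK (sphere_integralE mq qM).
  by rewrite -(fineK (integrable_fin_num measurableT iq)).
by move=> y t Sy t0; rewrite lnmaxdotE.
Qed.

Lemma maxdot_scale_at_lbound i s : exists2 e, 0 < e &
  forall N, sphere N -> e <= maxdot x (scale_at p i s) N.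
Proof.
have [e e0 eP] := supportf_lbound Sx FP.
(* Rescaling multiplies each weight by 1 or e^s, hence by at least [c]. *)
pose c := Num.min 1 (expR s); have c0 : 0 < c by rewrite lt_min ltr01 expR_gt0.
exists (c * e) => [|N SN]; first exact: mulr_gt0.
have [j [PN j0 _ _]] := polytope_linear_max Sx FP N.
apply: le_trans (le_maxdot x _ N j).
apply: (@le_trans _ _ (c * (p j * dotp (x j) N))).
  by rewrite ler_pM2l// -PN eP.
rewrite mulrA /scale_at; have d0 : 0 <= dotp (x j) N by move: j0; rewrite pmulr_rge0// p0.
apply: ler_wpM2r => //; case: eqP => _; rewrite ?ler_pM2r// ?ge_min ?lexx ?orbT//.
by rewrite ler_piMl ?ge_min ?lexx// ltW.
Qed.

(** Minimality bounds the change mu_i s of the weighted sum by the change of the integral, which the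
    pointwise estimate controls. The sign of [s] is free, so dividing by it gives a bound on either
    side. *)
Lemma mu_scale_le i s :
  mu i * s <= (n.+1)%:R * (s * fine (coneM R n (dominance x p i (expR s)))).
Proof.
set q := scale_at p i s; have q0 := scale_at_gt0 i p0 s.
have [e e0 qe] := maxdot_scale_at_lbound i s.
have [iq QKq] := QK_maxdot q0 e0 qe.
have [e' e'0 pe] := supportf_lbound Sx FP.
have [|ip QKp] := QK_maxdot p0 e'0.
  by move=> N SN; rewrite -supportf_maxdot//; exact: pe.
have PE : supportf P = maxdot x p by apply/funext => N; exact: supportf_maxdot.
have := Pmin (in_AK_maxdot nohemi q0).
rewrite PE QKp QKq lee_fin.
have := le_integral_indic (measurable_dominance x p i (expR s)) ip iq
  (lnmaxdot_scale_at i nohemi p0 s).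
have -> : \sum_j mu j * ln (q j) = \sum_j mu j * ln (p j) + mu i * s.
  rewrite (bigD1 i)//= [in RHS](bigD1 i)//= /q /scale_at eqxx.
  rewrite lnM ?posrE ?expR_gt0// expRK.
  under eq_bigr => j ji do rewrite (negbTE ji).
  ring.
rewrite -(@ler_pM2l _ n.+1%:R)// mulrDr; lra.
Qed.

Lemma sigma_gauss_map i :
  sigma (gauss_map P (x i)) = ((n.+1)%:R%:E * coneM R n (dominance x p i 1))%E.
Proof.
apply: sigma_coneM => y t Sy t0; rewrite (gauss_mapE Sx FP) /dominance/= maxdotZ//.
have M0 := maxdot_gt0 nohemi p0 Sy.
have scal j : p j * dotp (x j) (t *: y) = t * (p j * dotp (x j) y).
  by rewrite dotpZr mulrCA.
split => -[_ yj].
  split => // j; have [->//|/yj] := eqVneq j i.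
  by rewrite !scal mul1r ler_pM2l.
split => [|j _]; first exact: mulr_gt0.
by rewrite !scal mul1r ler_pM2l//; exact: yj.
Qed.

(** Continuity from above of a finite measure along s = 1/(k+1). *)
Lemma mu_le_coneM i : ((mu i / (n.+1)%:R)%:E <= coneM R n (dominance x p i 1))%E.
Proof.
have cvg : coneM R n (dominance x p i (expR k.+1%:R^-1)) @[k --> \oo] -->
    coneM R n (dominance x p i 1).
  rewrite -(bigcap_dominance x p i); apply: nonincreasing_cvg_mu.
  - by rewrite ltey_eq fin_num_measure//; exact: measurable_dominance.
  - by move=> k; exact: measurable_dominance.
  - by apply: bigcap_measurable => // k _; exact: measurable_dominance.
  - move=> k l kl; apply/subsetPset; apply: dominance_le => //.
    by rewrite ler_expR lef_pV2 ?posrE// ler_nat.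
rewrite -(cvg_lim _ cvg)//; apply: lime_ge; first by apply/cvg_ex; eexists; exact: cvg.
apply: nearW => k; have := mu_scale_le i k.+1%:R^-1.
rewrite -(@fineK _ (coneM R n _)) ?fin_num_measure//; last exact: measurable_dominance.
by rewrite lee_fin mulrCA mulrC ler_pM2l ?invr_gt0// ler_pdivrMr// mulrC.
Qed.

(** Continuity from below along s = -1/(k+1), the null hyperplanes of [dominance1_sub] accounting
    for the rest of the cone. *)
Lemma coneM_le_mu i : (coneM R n (dominance x p i 1) <= (mu i / (n.+1)%:R)%:E)%E.
Proof.
pose B k := dominance x p i (expR (- k.+1%:R^-1)).
pose H : set (lebT R n) :=
  \big[setU/set0]_(j in predC1 i) [set y : V | dotp (p j *: x j - p i *: x i) y = 0].
have mB k : measurable (B k) by exact: measurable_dominance.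
have mUB : measurable (\bigcup_k B k) by exact: bigcup_measurable.
have [mH H0] : measurable H /\ coneM R n H = 0%E.
  rewrite /H; elim/big_ind : _ => [|A A' [mA A0] [mA' A'0]|j ji].
  - by split => //; rewrite measure0.
  - by split; [exact: measurableU|rewrite measureU0].
  - split; last exact: coneM_hyperplane.
    have := measurable_dotp (p j *: x j - p i *: x i) measurableT (measurable_set1 0).
    by rewrite setTI.
apply: (@le_trans _ _ (coneM R n (\bigcup_k B k `|` H))).
  rewrite le_measure ?inE//; [exact: measurable_dominance|exact: measurableU|].
  exact: dominance1_sub.
have -> : coneM R n (\bigcup_k B k `|` H) = coneM R n (\bigcup_k B k) by exact: measureU0.
have cvg : coneM R n (B k) @[k --> \oo] --> coneM R n (\bigcup_k B k).
  apply: nondecreasing_cvg_mu => // k l kl; apply/subsetPset; apply: dominance_le => //.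
  by rewrite ler_expR lerN2 lef_pV2 ?posrE// ler_nat.
rewrite -(cvg_lim _ cvg)//; apply: lime_le; first by apply/cvg_ex; eexists; exact: cvg.
apply: nearW => k; have := mu_scale_le i (- k.+1%:R^-1).
rewrite -(@fineK _ (coneM R n (B k))) ?fin_num_measure//.
(* Here s is negative, so cancelling it reverses the inequality. *)
rewrite lee_fin mulrN mulNr mulrN lerN2 mulrCA [leRHS]mulrC ler_pM2l ?invr_gt0//.
by rewrite ler_pdivlMr// mulrC.
Qed.

Lemma sigma_gauss_map_minimizer i : sigma (gauss_map P (x i)) = (mu i)%:E.
Proof.
rewrite sigma_gauss_map.
have -> : coneM R n (dominance x p i 1) = (mu i / (n.+1)%:R)%:E.
  by apply/eqP; rewrite eq_le coneM_le_mu mu_le_coneM.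
by rewrite -EFinM mulrC divfK.
Qed.

End Minimizer.

Theorem theorem5 (R : realType) (n : nat) (K : nat)
  (x : 'I_K -> 'rV[R]_(n.+1)) (mu : 'I_K -> R)
  (P : set 'rV[R]_(n.+1)) :
  (0 < n)%N ->
  (* X_K = {x_1,...,x_K} is a set of K points of S^n *)
  (forall i, sphere (x i)) ->
  injective x ->
  (* not contained in any closed hemisphere *)
  (forall N, sphere N -> exists i, dotp (x i) N < 0) ->
  (forall i, 0 < mu i) ->
  ((\sum_(i < K) mu i)%:E = sigma (@sphere R n)) ->
  (forall (m : nat) (u : 'I_m.+1 -> 'rV[R]_(n.+1)),
     (forall j, sphere (u j)) ->
     poly_cone u <> [set: 'rV[R]_(n.+1)] ->
     ((\sum_(i < K | ~~ `[< (sphere `&` poly_cone u) (x i) >]) mu i)%:E >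
       sigma (dual_set (sphere `&` poly_cone u)))%E) ->
  in_FKn x P ->
  QK mu (supportf P) (fun i => radial P (x i)) =
    ereal_inf [set q | exists (h : 'rV[R]_(n.+1) -> R) (p : 'I_K -> R),
                         in_AK x h p /\ q = QK mu h p] ->
  QK mu (supportf P) (fun i => radial P (x i)) =
    ereal_inf [set QK mu (supportf F) (fun i => radial F (x i)) | F in in_FKn x] ->
  forall i, sigma (gauss_map P (x i)) = (mu i)%:E.
Proof.
move=> _ Sx xinj nohemi _ _ _ FP Pmin _; apply: sigma_gauss_map_minimizer => // h p hp.
by rewrite Pmin; apply: ereal_inf_lbound; exists h, p.
Qed.
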